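(* Let $\mathcal{E}$ be an extriangulated category, $C\subseteq as(\mathcal{E})$ a subset, $(X,\sigma)$ a $C$-compatible closed support on $\mathcal{E}$, and let $j: X\to Esp_C(\mathcal{E})$ be the map $x\mapsto\mathcal{P}_{X,\sigma}(x)$. Then: (1) $j$ is a morphism of supports $(X,\sigma)\to(Esp_C(\mathcal{E}),supp_C)$; that is, $(Esp_C(\mathcal{E}),supp_C)$ is the final support among all $C$-compatible closed supports. (2) $j$ is an immersion if $X$ is Noetherian and sober, $f_\sigma\circ g_\sigma=1_{pm(X)}$ (i.e. $f_\sigma(g_\sigma(W_x))=W_x$ for all $x\in X$), and $\{\sigma(E)\}_{E\in\mathcal{E}}$ is a closed basis for $X$. Moreover, in this case $j$ is a homeomorphism if and only if $j$ is surjective, that is, $C_{X,\sigma}=C$.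
   Context: $as(\mathcal{E})$ denotes the collection of non-empty full subcategories of $\mathcal{E}$ closed under finite direct sums and direct summands. For $C\subseteq as(\mathcal{E})$, $Esp_C(\mathcal{E})$ is the set $C$ with the topology whose closed sets are $Z_C(\mathcal{X})=\{\mathcal{P}\in C:\mathcal{P}\cap\mathcal{X}=\emptyset\}$, $\mathcal{X}$ ranging over classes of objects; $supp_C(E):=\{\mathcal{P}\in C: E\notin\mathcal{P}\}$. A support for $\mathcal{E}$ is a pair $(X,\sigma)$ with $X$ a topological space and $\sigma$ an assignment of a subset $\sigma(E)\subseteq X$ to each object $E$ such that $\sigma(0)=\emptyset$ and $\sigma(E\oplus F)=\sigma(E)\cup\sigma(F)$ (so $\sigma$ depends only on isomorphism classes). It is closed if all $\sigma(E)$ are closed. A morphism of supports $f:(X,\sigma)\to(Y,\tau)$ is a continuous map $f:X\to Y$ with $\sigma(E)=f^{-1}(\tau(E))$ for all $E\in\mathcal{E}$. Put $\mathcal{P}_{X,\sigma}(x):=\{E\in\mathcal{E}: x\notin\sigma(E)\}$ and $C_{X,\sigma}:=\{\mathcal{P}_{X,\sigma}(x): x\in X\}$. The support is $C$-compatible if $\mathcal{P}_{X,\sigma}(x)\in C$ for all $x\in X$. For $\mathcal{N}\in as(\mathcal{E})$ and $S\subseteq X$: $f_\sigma(\mathcal{N}):=\bigcup_{N\in\mathcal{N}}\sigma(N)$ and $g_\sigma(S):=\{E\in\mathcal{E}:\sigma(E)\subseteq S\}$. Also $W_x:=\{x'\in X: x\notin\overline{\{x'\}}\}$ and $pm(X):=\{W_x\}_{x\in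 X}$. A closed basis is a family of closed sets such that every closed set is an intersection of members of the family. An immersion is a homeomorphism onto its image with the subspace topology. *)

(* Defs.v *)
From HB Require Import structures.
From mathcomp Require Import all_boot all_algebra.
From mathcomp Require Import all_classical.
From mathcomp Require Import topology.
Set Implicit Arguments.
Unset Strict Implicit.
Unset Printing Implicit Defensive.
Import GRing.Theory.
Local Open Scope classical_set_scope.
Local Open Scope ring_scope.

(** * Additive categories *)

Record preaddCat := PreaddCat {
  Obj :> Type;
  hom : Obj -> Obj -> zmodType;
  idm : forall A, hom A A;
  comp : forall A B C, hom B C -> hom A B -> hom A C;
  compA : forall A B C D (h : hom C D) (g : hom B C) (f : hom A B),
    comp h (comp g f) = comp (comp h g) f;
  comp1m : forall A B (f : hom A B), comp (idm B) f = f;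
  compm1 : forall A B (f : hom A B), comp f (idm A) = f;
  compDl : forall A B C (g g' : hom B C) (f : hom A B),
    comp (g + g') f = comp g f + comp g' f;
  compDr : forall A B C (g : hom B C) (f f' : hom A B),
    comp g (f + f') = comp g f + comp g f' }.

Arguments hom {p} A B.
Arguments idm {p} A.
Arguments comp {p A B C} g f.
Notation "g \oc f" := (comp g f) (at level 40, left associativity).

Section Preadditive.
Variable K : preaddCat.
Implicit Types A B C S Z : K.

Definition is_iso A B (f : hom A B) : Prop :=
  exists g : hom B A, g \oc f = idm A /\ f \oc g = idm B.

Definition is_zero Z : Prop :=
  (forall A (f g : hom A Z), f = g) /\ (forall A (f g : hom Z A), f = g).

(** [biprod A B S]: the structure of a direct sum [A (+) B] on [S]. *)
Record biprod A B S := Biprod {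
  in1 : hom A S;
  in2 : hom B S;
  pr1 : hom S A;
  pr2 : hom S B;
  pr1_in1 : pr1 \oc in1 = idm A;
  pr2_in2 : pr2 \oc in2 = idm B;
  pr1_in2 : pr1 \oc in2 = 0;
  pr2_in1 : pr2 \oc in1 = 0;
  in_pr : in1 \oc pr1 + in2 \oc pr2 = idm S }.

Definition is_biprod A B S : Prop := inhabited (biprod A B S).

Definition hom_sum A A' S B B' T (a : biprod A A' S) (b : biprod B B' T)
    (f : hom A B) (f' : hom A' B') : hom S T :=
  in1 b \oc f \oc pr1 a + in2 b \oc f' \oc pr2 a.

Definition seq_equiv A B B' C (x : hom A B) (y : hom B C)
    (x' : hom A B') (y' : hom B' C) : Prop :=
  exists b : hom B B', [/\ is_iso b, b \oc x = x' & y' \oc b = y].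

End Preadditive.

Record addCat := AddCat {
  preadd :> preaddCat;
  zero_ex : exists Z : preadd, is_zero Z;
  biprod_ex : forall A B : preadd, exists S, is_biprod A B S }.

(** * Extriangulated categories (Nakaoka-Palu) *)

(** A biadditive functor [Ext : K^op * K -> Ab]; [push a] is [a_*] and
    [pull c] is [c^*]. *)
Record extBifunctor (K : addCat) := ExtBifunctor {
  Ext : K -> K -> zmodType;
  push : forall C A A' : K, hom A A' -> Ext C A -> Ext C A';
  pull : forall C C' A : K, hom C' C -> Ext C A -> Ext C' A;
  push1 : forall C A (d : Ext C A), push (idm A) d = d;
  push_comp : forall C A A' A'' (a' : hom A' A'') (a : hom A A') (d : Ext C A),
    push (a' \oc a) d = push a' (push a d);
  pull1 : forall C A (d : Ext C A), pull (idm C) d = d;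
  pull_comp : forall C C' C'' A (c : hom C' C) (c' : hom C'' C') (d : Ext C A),
    pull (c \oc c') d = pull c' (pull c d);
  push_pull : forall C C' A A' (a : hom A A') (c : hom C' C) (d : Ext C A),
    push a (pull c d) = pull c (push a d);
  pushD : forall C A A' (a : hom A A') (d d' : Ext C A),
    push a (d + d') = push a d + push a d';
  pullD : forall C C' A (c : hom C' C) (d d' : Ext C A),
    pull c (d + d') = pull c d + pull c d';
  push_add : forall C A A' (a a' : hom A A') (d : Ext C A),
    push (a + a') d = push a d + push a' d;
  pull_add : forall C C' A (c c' : hom C' C) (d : Ext C A),
    pull (c + c') d = pull c d + pull c' d }.

Arguments Ext {K} e C A.
Arguments push {K e C A A'} a d.
Arguments pull {K e C C' A} c d.

Section Realization.
Variables (K : addCat) (E : extBifunctor K).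

Definition ext_morphism (C A C' A' : K) (d : Ext E C A) (d' : Ext E C' A')
    (a : hom A A') (c : hom C C') : Prop :=
  push a d = pull c d'.

(** The element of [Ext (C (+) C') (A (+) A')] corresponding to
    [(d, 0, 0, d')]. *)
Definition ext_sum (C C' SC A A' SA : K) (c : biprod C C' SC)
    (a : biprod A A' SA) (d : Ext E C A) (d' : Ext E C' A') : Ext E SC SA :=
  push (in1 a) (pull (pr1 c) d) + push (in2 a) (pull (pr2 c) d').

(** [s d x y] means that the equivalence class [s(d)] is that of the
    sequence [A -x-> B -y-> C]. *)
Definition correspondence :=
  forall A B C : K, Ext E C A -> hom A B -> hom B C -> Prop.

Record is_realization (s : correspondence) : Prop := IsRealization {
  real_ex : forall (A C : K) (d : Ext E C A),
    exists (B : K) (x : hom A B) (y : hom B C), s A B C d x y;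
  real_class : forall (A B C : K) (d : Ext E C A) (x : hom A B) (y : hom B C),
    s A B C d x y ->
    forall (B' : K) (x' : hom A B') (y' : hom B' C),
      s A B' C d x' y' <-> seq_equiv x y x' y';
  real_morph : forall (A B C A' B' C' : K)
    (d : Ext E C A) (x : hom A B) (y : hom B C)
    (d' : Ext E C' A') (x' : hom A' B') (y' : hom B' C')
    (a : hom A A') (c : hom C C'),
    s A B C d x y -> s A' B' C' d' x' y' -> ext_morphism d d' a c ->
    exists b : hom B B', b \oc x = x' \oc a /\ y' \oc b = c \oc y }.

Record is_additive_realization (s : correspondence) : Prop :=
  IsAdditiveRealization {
  addreal_real : is_realization s;
  addreal0 : forall (A C S : K) (b : biprod A C S),
    s A S C 0 (in1 b) (pr2 b);
  addrealD : forall (A B C A' B' C' SA SB SC : K)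
    (a : biprod A A' SA) (b : biprod B B' SB) (c : biprod C C' SC)
    (d : Ext E C A) (x : hom A B) (y : hom B C)
    (d' : Ext E C' A') (x' : hom A' B') (y' : hom B' C'),
    s A B C d x y -> s A' B' C' d' x' y' ->
    s SA SB SC (ext_sum c a d d') (hom_sum a b x x') (hom_sum b c y y') }.

Definition ET3 (s : correspondence) : Prop :=
  forall (A B C A' B' C' : K)
    (d : Ext E C A) (x : hom A B) (y : hom B C)
    (d' : Ext E C' A') (x' : hom A' B') (y' : hom B' C')
    (a : hom A A') (b : hom B B'),
  s A B C d x y -> s A' B' C' d' x' y' -> b \oc x = x' \oc a ->
  exists c : hom C C', c \oc y = y' \oc b /\ ext_morphism d d' a c.

Definition ET3op (s : correspondence) : Prop :=
  forall (A B C A' B' C' : K)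
    (d : Ext E C A) (x : hom A B) (y : hom B C)
    (d' : Ext E C' A') (x' : hom A' B') (y' : hom B' C')
    (b : hom B B') (c : hom C C'),
  s A B C d x y -> s A' B' C' d' x' y' -> c \oc y = y' \oc b ->
  exists a : hom A A', b \oc x = x' \oc a /\ ext_morphism d d' a c.

(**
<<
      A --f--> B --f'--> D
      ||       |g        |u
      A --h--> C --h'--> M
               |g'       |v
               F  =====  F
>> *)
Definition ET4 (s : correspondence) : Prop :=
  forall (A B C D F : K)
    (d : Ext E D A) (f : hom A B) (f' : hom B D)
    (d' : Ext E F B) (g : hom B C) (g' : hom C F),
  s A B D d f f' -> s B C F d' g g' ->
  exists (M : K) (h : hom A C) (h' : hom C M) (u : hom D M) (v : hom M F)
    (d'' : Ext E M A),
  [/\ [/\ h = g \oc f, h' \oc g = u \oc f' & v \oc h' = g'],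
      s A C M d'' h h',
      s D M F (push f' d') u v,
      pull u d'' = d &
      push f d'' = pull v d'].

(**
<<
      D --u---> M --v--> F
      ||        |h'      |g'
      D --f'--> A --f--> B
                |h       |g
                C  ====  C
>> *)
Definition ET4op (s : correspondence) : Prop :=
  forall (A B C D F : K)
    (d : Ext E B D) (f' : hom D A) (f : hom A B)
    (d' : Ext E C F) (g' : hom F B) (g : hom B C),
  s D A B d f' f -> s F B C d' g' g ->
  exists (M : K) (u : hom D M) (v : hom M F) (h' : hom M A) (h : hom A C)
    (d'' : Ext E C M),
  [/\ [/\ h' \oc u = f', f \oc h' = g' \oc v & h = g \oc f],
      s M A C d'' h' h,
      s D M F (pull g' d) u v,
      push v d'' = d' &
      push u d = pull g d''].

End Realization.

Record extriCat := ExtriCat {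
  addcat :> addCat;
  extfun : extBifunctor addcat;
  real : correspondence extfun;
  real_additive : is_additive_realization real;
  real_ET3 : ET3 real;
  real_ET3op : ET3op real;
  real_ET4 : ET4 real;
  real_ET4op : ET4op real }.

(** * Topological preliminaries *)

Section Topology.
Implicit Types X Y : topologicalType.

Definition homeomorphism X Y (f : X -> Y) : Prop :=
  continuous f /\
  exists g : Y -> X, [/\ continuous g, cancel f g & cancel g f].

(** The type [range f] carries the subspace topology. *)
Definition corestrict X Y (f : X -> Y) (x : X) : range f :=
  SigSub (mem_set (imageT f x)).

Definition immersion X Y (f : X -> Y) : Prop := homeomorphism (corestrict f).

Definition noetherian_space X : Prop :=
  forall F : nat -> set X,
    (forall n, closed (F n)) -> (forall n, F n.+1 `<=` F n) ->
    exists n, forall m, (n <= m)%N -> F m = F n.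

Definition irreducible_closed X (Z : set X) : Prop :=
  [/\ closed Z, Z !=set0 &
      forall A B, closed A -> closed B -> Z = A `|` B -> Z = A \/ Z = B].

Definition sober X : Prop :=
  forall Z : set X, irreducible_closed Z -> exists! x, closure [set x] = Z.

Definition closed_basis X (B : set (set X)) : Prop :=
  (forall A, B A -> closed A) /\
  (forall Z, closed Z ->
     exists D : set (set X), D `<=` B /\ Z = \bigcap_(A in D) A).

Definition Wset X (x : X) : set X := [set x' | ~ closure [set x'] x].

Definition pm X : set (set X) := range (@Wset X).

End Topology.

Arguments pm X : clear implicits.

(** * Supports *)

Section Supports.
Variable E : extriCat.

(** A full subcategory of [E] is given by its collection of objects. *)
Record is_as (P : set E) : Prop := IsAs {
  as_neq0 : P !=set0;
  as_zero : forall Z, is_zero Z -> P Z;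
  as_sum : forall A B S, is_biprod A B S -> P A -> P B -> P S;
  as_summand : forall A B S, is_biprod A B S -> P S -> P A }.

Definition as_cat : set (set E) := [set P | is_as P].

(** Direct sums and zero objects are determined only up to isomorphism: the
    conditions are imposed on all of them. *)
Record is_support (X : topologicalType) (sigma : E -> set X) : Prop :=
  IsSupport {
  supp_zero : forall Z, is_zero Z -> sigma Z = set0;
  supp_sum : forall A B S, is_biprod A B S -> sigma S = sigma A `|` sigma B }.

Definition closed_support (X : topologicalType) (sigma : E -> set X) : Prop :=
  is_support sigma /\ forall A, closed (sigma A).

Definition support_morphism (X Y : topologicalType)
    (sigma : E -> set X) (tau : E -> set Y) (f : X -> Y) : Prop :=
  continuous f /\ forall A, sigma A = f @^-1` (tau A).

Definition Psupp (X : topologicalType) (sigma : E -> set X) (x : X) : set E :=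
  [set A | ~ sigma A x].

Definition Csupp (X : topologicalType) (sigma : E -> set X) : set (set E) :=
  range (Psupp sigma).

Definition compatible (C : set (set E)) (X : topologicalType)
    (sigma : E -> set X) : Prop :=
  forall x, C (Psupp sigma x).

Definition fsupp (X : topologicalType) (sigma : E -> set X) (N : set E) :
    set X :=
  \bigcup_(A in N) sigma A.

Definition gsupp (X : topologicalType) (sigma : E -> set X) (S : set X) :
    set E :=
  [set A | sigma A `<=` S].

Lemma Psupp_as (X : topologicalType) (sigma : E -> set X) x :
  is_support sigma -> as_cat (Psupp sigma x).
Proof.
move=> [s0 sD]; split; rewrite /Psupp /=.
- by have [Z Z0] := zero_ex E; exists Z => /=; rewrite s0.
- by move=> Z /s0 ->.
- by move=> A B T /sD -> nA nB [].
- by move=> A B T /sD -> h ?; apply: h; left.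
Qed.

Lemma gsupp_as (X : topologicalType) (sigma : E -> set X) S :
  is_support sigma -> as_cat (gsupp sigma S).
Proof.
move=> [s0 sD]; split; rewrite /gsupp /=.
- by have [Z Z0] := zero_ex E; exists Z => /=; rewrite s0.
- by move=> Z /s0 ->.
- by move=> A B T /sD -> hA hB x [/hA|/hB].
- by move=> A B T /sD -> h x ?; apply: h; left.
Qed.

(** ** The space [Esp_C(E)] *)

(** The inclusion of [C] in [as(E)] is what makes the sets [Z_C(X)] the closed
    sets of a topology, hence the parameter [hC]. *)
Definition Esp (C : set (set E)) (hC : C `<=` as_cat) : Type := {P | C P}.

Section EspTopology.
Variables (C : set (set E)) (hC : C `<=` as_cat).

Definition Zset (X : set E) : set (Esp hC) :=
  [set P | sval P `&` X = set0].

Definition Esp_open : set_system (Esp hC) :=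
  [set U | exists X, ~` U = Zset X].

Lemma biprod_sym (A B S : E) : is_biprod A B S -> is_biprod B A S.
Proof.
case=> [[i1 i2 p1 p2 h1 h2 h3 h4 h5]]; constructor.
by exists i2 i1 p2 p1 => //; rewrite addrC.
Qed.

Lemma Esp_open_setT : Esp_open setT.
Proof.
exists setT; rewrite setCT; apply/seteqP; split=> // -[P CP] /= PT0.
have [[A PA] _ _ _] := hC CP.
by rewrite -[False]/(set0 A) -PT0; split.
Qed.

Lemma Esp_openI : setI_closed Esp_open.
Proof.
move=> U V [X UX] [Y VY].
exists [set S | exists A B, [/\ X A, Y B & is_biprod A B S]].
rewrite setCI UX VY; apply/seteqP; split=> -[P CP].
  have [_ _ _ Psm] := hC CP.
  case=> /= /disjoints_subset PN; apply/disjoints_subset => S PS.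
    by case=> [A [B [XA _ AB]]]; apply: PN XA; apply: Psm AB PS.
  by case=> [A [B [_ YB AB]]]; apply: PN YB; apply: Psm (biprod_sym AB) PS.
move=> /disjoints_subset PN; apply: contrapT => /not_orP[/= /eqP/set0P[A [PA XA]]].
move=> /eqP/set0P[B [PB YB]]; have [S AB] := biprod_ex A B.
have [_ _ Psum _] := hC CP.
by apply: (PN S (Psum _ _ _ AB PA PB)); exists A, B.
Qed.

Lemma Esp_open_bigU (J : Type) (f : J -> set (Esp hC)) :
  (forall i, Esp_open (f i)) -> Esp_open (\bigcup_i f i).
Proof.
move=> /choice[X fX]; exists (\bigcup_i X i); rewrite setC_bigcup.
apply/seteqP; split=> P.
  move=> fP; apply/disjoints_subset => A PA [i _ XA].
  by have := fP i I; rewrite fX => /disjoints_subset/(_ A PA).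
move=> /disjoints_subset PN i _; rewrite fX; apply/disjoints_subset => A PA XA.
by apply: (PN A PA); exists i.
Qed.

HB.instance Definition _ := gen_eqMixin (Esp hC).
HB.instance Definition _ := gen_choiceMixin (Esp hC).
HB.instance Definition _ :=
  isOpenTopological.Build (Esp hC) Esp_open_setT Esp_openI Esp_open_bigU.

Lemma Esp_closedE (F : set (Esp hC)) :
  closed F <-> exists X, F = Zset X.
Proof. by rewrite -openC -[open _]/(Esp_open _) /Esp_open /= setCK. Qed.

Definition supp (A : E) : set (Esp hC) := [set P | ~ sval P A].

Definition to_Esp (X : topologicalType) (sigma : E -> set X)
    (hsigma : compatible C sigma) (x : X) : Esp hC :=
  exist _ (Psupp sigma x) (hsigma x).

End EspTopology.

Definition final_support (C : set (set E)) (Y : topologicalType)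
    (tau : E -> set Y) : Prop :=
  [/\ closed_support tau, compatible C tau &
      forall (X : topologicalType) (sigma : E -> set X),
        closed_support sigma -> compatible C sigma ->
        exists! f : X -> Y, support_morphism sigma tau f].

End Supports.

Arguments as_cat E : clear implicits.
Arguments supp {E C} hC A.

(* Main.v *)
Require Import Defs.
From mathcomp Require Import all_boot all_algebra.
From mathcomp Require Import all_classical.
From mathcomp Require Import topology.
Local Open Scope classical_set_scope.

(** The preimage under [j] of the basic closed set attached to a class of
    objects [N] is the intersection of the [sigma A] for [A] in [N], so [j] is
    continuous.  When the sets [sigma A] form a closed basis these preimages
    exhaust the closed sets of [X], so [X] carries the topology induced by [j],
    and points with the same image have the same closure; sobriety then makes
    [j] injective. *)

(** A closed set through [x] contains the whole closure of [x], so in a decomposition [A] or [B],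
    whichever contains [x], is everything. *)
Lemma closure_irreducible (X : topologicalType) (x : X) :
  irreducible_closed (closure [set x]).
Proof.
have sub A : closed A -> A x -> closure [set x] `<=` A.
  by move=> cA Ax; rewrite closureE; apply: smallest_sub => // _ ->.
split; [exact: closed_closure | by exists x; exact: subset_closure |].
move=> A B cA cB eqAB.
have : closure [set x] x by exact: subset_closure.
rewrite {1}eqAB => -[Ax|Bx]; [left|right]; apply/seteqP; split; try exact: sub.
  by rewrite eqAB; exact: subsetUl.
by rewrite eqAB; exact: subsetUr.
Qed.

Lemma sober_closure_inj (X : topologicalType) (x y : X) :
  sober X -> closure [set x] = closure [set y] -> x = y.
Proof.
move=> sX eqxy; have [z [_ uz]] := sX _ (closure_irreducible X x).
by rewrite -(uz x) // -(uz y).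
Qed.

(** The last hypothesis makes the inverse on the image continuous: it pulls a closed set, written as
    the preimage of [W], back to the trace of [W] on the range. *)
Lemma closed_induced_immersion (X Y : topologicalType) (f : X -> Y) :
  continuous f -> injective f ->
  (forall Z, closed Z -> exists2 W, closed W & Z = f @^-1` W) ->
  immersion f.
Proof.
move=> cf injf indf; split; first exact: continuous_comp_initial.
have /choice[g gP] : forall y : range f, exists x, f x = val y.
  by move=> [y Ry]; have [x _ xy] := set_mem Ry; exists x.
exists g; split.
- apply/continuous_closedP => Z /indf[W cW ->].
  rewrite (_ : g @^-1` _ = val @^-1` W); last first.
    by apply/seteqP; split=> y /=; rewrite gP.
  move/continuous_closedP: (@initial_continuous (range f) Y val); exact.
- by move=> x; apply: injf; rewrite gP.
- by move=> y; apply: val_inj; rewrite /= gP.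
Qed.

(** When [f] is onto, the inclusion of its range into [Y] is itself a homeomorphism. Its inverse [u]
    is continuous because the range carries the initial topology for [val]. *)
Lemma immersion_homeomorphism (X Y : topologicalType) (f : X -> Y) :
  immersion f -> homeomorphism f <-> range f = setT.
Proof.
move=> [cf [g [cg fK gK]]]; split=> [[_ [h [_ _ hK]]]|surjf].
  by apply/seteqP; split=> // y _; exists (h y).
have Rf y : y \in range f by apply: mem_set; rewrite surjf.
pose u y : range f := SigSub (Rf y).
have cu : continuous u by apply: continuous_comp_initial => y U.
have fE : f = val \o corestrict f by [].
split.
  rewrite fE => x; apply: continuous_comp; first exact: cf.
  exact: initial_continuous.
have uf x : u (f x) = corestrict f x by exact: val_inj.
exists (g \o u); split.
- by move=> y; apply: continuous_comp; [exact: cu | exact: cg].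
- by move=> x; rewrite /= uf fK.
(* By [gK], [u y] is the corestriction of [f] at [g (u y)], and its value in [Y] is [f (g (u y))] by
   conversion. *)
- by move=> y; rewrite -[RHS]/(val (u y)) -[in RHS](gK (u y)).
Qed.

(** Of the two inclusions for a direct sum, one is closure under sums and the other closure under
    summands, applied on either side. The support of [A] is closed because it is [Zset] of the
    singleton of [A]. *)
Lemma closed_support_supp (E : extriCat) (C : set (set E))
    (hC : C `<=` as_cat E) : closed_support (supp hC).
Proof.
split; first split.
- move=> Z Z0; apply/seteqP; split=> // -[P CP] /=; apply.
  by have [_ + _ _] := hC _ CP; apply.
- move=> A B S AB; apply/seteqP; split=> -[P CP] /=; rewrite /supp /=;
    have [_ _ Psum Psm] := hC _ CP.
    by move=> nS; apply/not_andP => -[PA PB]; apply: nS; exact: Psum AB PA PB.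
  case=> n PS; apply: n; first exact: Psm AB PS.
  exact: Psm (biprod_sym AB) PS.
- move=> A; apply/Esp_closedE; exists [set A]; apply/seteqP.
  split=> -[P CP]; rewrite /supp /Zset /=.
    by move=> nPA; apply/seteqP; split=> // B [PB BA]; apply: nPA; rewrite -BA.
  by move=> + PA; rewrite -subset0 => /(_ A); apply.
Qed.

Lemma compatible_supp (E : extriCat) (C : set (set E)) (hC : C `<=` as_cat E) :
  compatible C (supp hC).
Proof.
move=> [P CP]; rewrite (_ : Psupp _ _ = P) //.
by apply/seteqP; split=> A; rewrite /Psupp /supp /= notK.
Qed.

Lemma preimage_Zset (E : extriCat) (C : set (set E)) (hC : C `<=` as_cat E)
    (X : topologicalType) (sigma : E -> set X) (C_sigma : compatible C sigma)
    (N : set E) :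
  to_Esp hC C_sigma @^-1` Zset N = \bigcap_(A in N) sigma A.
Proof.
apply/seteqP; split=> x; rewrite /Zset /Psupp /=.
  by rewrite -subset0 => sN A NA; apply: contrapT => nA; apply: (sN A).
by move=> sN; rewrite -subset0 => A [nA NA]; apply/nA/sN.
Qed.

Lemma support_morphism_to_Esp (E : extriCat) (C : set (set E))
    (hC : C `<=` as_cat E) (X : topologicalType) (sigma : E -> set X)
    (closed_sigma : closed_support sigma) (C_sigma : compatible C sigma) :
  support_morphism sigma (supp hC) (to_Esp hC C_sigma).
Proof.
split; last first.
  by move=> A; apply/seteqP; split=> x; rewrite /supp /Psupp /= notK.
apply/continuous_closedP => F /Esp_closedE[N ->].
by rewrite preimage_Zset; apply: closed_bigI => A _; exact: closed_sigma.2.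
Qed.

Lemma final_support_Esp (E : extriCat) (C : set (set E))
    (hC : C `<=` as_cat E) : final_support C (supp hC).
Proof.
split; [exact: closed_support_supp | exact: compatible_supp |].
move=> X sigma cs Cs; exists (to_Esp hC Cs); split.
  exact: support_morphism_to_Esp.
(* Uniqueness does not involve continuity: [sf] says that [A] lies outside [f x] exactly when [x] is
   in [sigma A], which determines the subcategory [f x]. *)
move=> f [_ sf]; apply/funext => x.
apply: eq_sig_hprop => [P|]; first exact: Prop_irrelevance.
apply/seteqP; split=> A; rewrite /= /Psupp /= sf /supp /=; first exact: contrapT.
by move=> ?; apply.
Qed.

Lemma to_Esp_immersion (E : extriCat) (C : set (set E)) (hC : C `<=` as_cat E)
    (X : topologicalType) (sigma : E -> set X)
    (closed_sigma : closed_support sigma) (C_sigma : compatible C sigma) :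
  sober X -> closed_basis (range sigma) -> immersion (to_Esp hC C_sigma).
Proof.
move=> sX [_ basis].
have cj := (support_morphism_to_Esp E C hC X sigma closed_sigma C_sigma).1.
have ind Z : closed Z -> exists2 W, closed W & Z = to_Esp hC C_sigma @^-1` W.
  (* [D] is a family of subsets of [X]; the matching class of objects consists of those whose
     support belongs to [D]. *)
  move=> /basis[D [sD ->]]; exists (Zset (sigma @^-1` D)).
    by apply/Esp_closedE; eexists.
  rewrite preimage_Zset; apply/seteqP; split=> x xD A DA; first exact: xD DA.
  by have [B _ BA] := sD _ DA; rewrite -BA; apply: xD; rewrite /= BA.
apply: closed_induced_immersion => // x y jxy.
apply: sober_closure_inj => //.
suff sub u v : to_Esp hC C_sigma u = to_Esp hC C_sigma v ->
    closure [set u] `<=` closure [set v].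
  by apply/seteqP; split; apply: sub.
move=> juv; rewrite [X in X `<=` _]closureE.
apply: smallest_sub; first exact: closed_closure.
(* The closure of [v] is the preimage of some [W], so it contains every point with the same image as
   [v], in particular [u]. *)
move=> _ ->; have [W _ eW] := ind _ (@closed_closure _ [set v]).
have : closure [set v] v by exact: subset_closure.
by rewrite eW /= juv.
Qed.

Lemma to_Esp_surjective (E : extriCat) (C : set (set E)) (hC : C `<=` as_cat E)
    (X : topologicalType) (sigma : E -> set X) (C_sigma : compatible C sigma) :
  range (to_Esp hC C_sigma) = setT <-> Csupp sigma = C.
Proof.
split=> [surj|eqC].
  apply/seteqP; split=> [_ [x _ <-]|P CP]; first exact: C_sigma.
  have : [set: Esp hC] (exist _ P CP) by [].
  by rewrite -surj => -[x _ /(congr1 sval) /= jx]; exists x.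
apply/seteqP; split=> // -[P CP] _.
have : Csupp sigma P by rewrite eqC.
(* Points of [Esp hC] with equal underlying subcategories are equal, since membership in [C] is
   proof-irrelevant. *)
by case=> x _ xP; exists x => //; exact: eq_exist.
Qed.

Theorem theorem5p10 (E : extriCat) (C : set (set E)) (hC : C `<=` as_cat E)
    (X : topologicalType) (sigma : E -> set X)
    (closed_sigma : closed_support sigma) (C_sigma : compatible C sigma) :
  let j : X -> Esp hC := to_Esp hC C_sigma in
  (support_morphism sigma (supp hC) j /\ final_support C (supp hC)) /\
  (noetherian_space X -> sober X ->
   (forall S : set X, pm X S -> fsupp sigma (gsupp sigma S) = S) ->
   closed_basis (range sigma) ->
   immersion j /\
   (homeomorphism j <-> range j = setT) /\
   (range j = setT <-> Csupp sigma = C)).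
Proof.
move=> j; split.
  by split; [exact: support_morphism_to_Esp | exact: final_support_Esp].
move=> _ sX _ basis.
have immj : immersion j by exact: to_Esp_immersion.
split=> //; split; first exact: immersion_homeomorphism.
exact: to_Esp_surjective.
Qed.
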